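(* Let $m$ be a fixed positive integer, let $l$ be a nonnegative integer and let $p=n^{\alpha}$, where $\alpha\in\left[\frac{-1}{l+2},0\right]$. Then asymptotically almost surely $\tilde H_l(N_m(G(n,p)))=0$.
   Context: $G(n,p)$ is the Erdős–Rényi random graph on $n$ vertices in which each edge appears independently with probability $p$. For a graph $G$ and a nonnegative integer $m$, the multineighbor complex $N_m(G)$ is the simplicial complex in which a set of $q+1$ vertices of $G$ ($q\ge 0$) is a $q$-simplex if and only if these vertices have at least $m$ common neighbors in $G$. $\tilde H_*$ denotes reduced simplicial homology with integer coefficients. A property holds asymptotically almost surely (a.a.s.) if its probability tends to $1$ as $n\to\infty$. Here $l$, $m$ and $\alpha$ are fixed as $n\to\infty$. *)

(* Defs.v *)
From HB Require Import structures.
From mathcomp Require Import all_boot all_order all_algebra.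
From mathcomp Require Import ring_quotient.
From mathcomp Require Import all_classical all_reals all_analysis.
(* Shadows the homonymous constants of classical_sets (set0, setT, ...). *)
From mathcomp Require Import finset.
Import Order.TTheory GRing.Theory Num.Theory.
Import numFieldNormedType.Exports.

Set Implicit Arguments.
Unset Strict Implicit.
Unset Printing Implicit Defensive.

Local Open Scope ring_scope.

(** * Finite simplicial complexes and their reduced homology over [int] *)

Record simplicial_complex (n : nat) := SimplicialComplex {
  simplices : {set {set 'I_n}};
  simplices_neq0 : set0 \notin simplices;
  simplices_sub : forall s t : {set 'I_n},
    s \in simplices -> t \subset s -> t != set0 -> t \in simplices
}.

Section Homology.
Variables (n : nat) (K : simplicial_complex n).

(* The empty face spans the augmentation term C_{-1} = Z.  Faces are graded
   by cardinality, so [face k] indexes a basis of the chains of degree k - 1. *)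
Definition face (k : nat) :=
  {s : {set 'I_n} | ((s == set0) || (s \in simplices K)) && (#|s| == k)}.

Definition chain (k : nat) := {ffun face k -> int}.

(* Simplices are oriented by the order of 'I_n: for s = {v_0 < ... < v_q},
   the boundary of s is the sum over i of (-1)^i (s \ v_i), and [incidence s t]
   is the coefficient of t in it. *)
Definition incidence (s t : {set 'I_n}) : int :=
  \sum_(v in s | s :\ v == t) (-1) ^+ #|[set u in s | (u < v)%N]|.

Definition boundary (k : nat) (c : chain k.+1) : chain k :=
  [ffun t : face k => \sum_(s : face k.+1) c s * incidence (val s) (val t)].

Fact boundary_is_zmod_morphism k : zmod_morphism (@boundary k).
Proof.
move=> c d; apply/ffunP => t; rewrite !ffunE -sumrB.
by apply: eq_bigr => s _; rewrite !ffunE mulrBl.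
Qed.

HB.instance Definition _ k := GRing.isZmodMorphism.Build
  (chain k.+1) (chain k) (@boundary k) (@boundary_is_zmod_morphism k).

Definition is_cycle (l : nat) : {pred chain l.+1} :=
  [pred c | boundary c == 0].

Fact is_cycle_zmod_closed l : zmod_closed (@is_cycle l).
Proof.
split=> [|c d]; rewrite !inE ?raddf0 // => /eqP c0 /eqP d0.
by rewrite raddfB /= c0 d0 subrr.
Qed.

HB.instance Definition _ l :=
  GRing.isZmodClosed.Build (chain l.+1) (@is_cycle l) (@is_cycle_zmod_closed l).

Record cycle (l : nat) := Cycle {
  cycle_val :> chain l.+1;
  cycle_valP : cycle_val \in @is_cycle l
}.

HB.instance Definition _ l := [isSub for @cycle_val l].
HB.instance Definition _ l := [Choice of cycle l by <:].
HB.instance Definition _ l := [SubChoice_isSubZmodule of cycle l by <:].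

Definition is_boundary (l : nat) : {pred cycle l} :=
  [pred z : cycle l | `[< exists d : chain l.+2, cycle_val z = boundary d >]].

Fact is_boundary_zmod_closed l : zmod_closed (@is_boundary l).
Proof.
split=> [|y z]; rewrite !inE; first by apply/asboolP; exists 0; rewrite !raddf0.
move=> /asboolP[c yc] /asboolP[d zd]; apply/asboolP; exists (c - d).
by rewrite raddfB /= -yc -zd.
Qed.

HB.instance Definition _ l := GRing.isZmodClosed.Build
  (cycle l) (@is_boundary l) (@is_boundary_zmod_closed l).

Definition reduced_homology (l : nat) : zmodType :=
  Quotient.quot (@is_boundary l).

End Homology.

(** * Random graphs *)

Definition vertex_pair (n : nat) := {e : {set 'I_n} | #|e| == 2}.

(* A simple graph on 'I_n is its set of edges. *)
Definition graph (n : nat) := {set vertex_pair n}.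

Definition edge_rel (n : nat) (G : graph n) (u v : 'I_n) : bool :=
  [exists e in G, val e == [set u; v]].

Definition common_neighbors (n : nat) (G : graph n) (s : {set 'I_n}) :
    {set 'I_n} :=
  [set v | [forall u in s, edge_rel G u v]].

Definition multineighbor_simplices (m n : nat) (G : graph n) :
    {set {set 'I_n}} :=
  [set s | (s != set0) && (m <= #|common_neighbors G s|)%N].

Fact multineighbor_neq0 m n (G : graph n) :
  set0 \notin multineighbor_simplices m G.
Proof. by rewrite inE eqxx. Qed.

Fact multineighbor_sub m n (G : graph n) (s t : {set 'I_n}) :
  s \in multineighbor_simplices m G -> t \subset s -> t != set0 ->
  t \in multineighbor_simplices m G.
Proof.
rewrite !inE => /andP[_ ms] ts -> /=; apply: leq_trans ms _.
apply/subset_leq_card/fintype.subsetP => v; rewrite !inE => /forall_inP sv.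
by apply/forall_inP => u /(fintype.subsetP ts); apply: sv.
Qed.

Definition multineighbor_complex (m n : nat) (G : graph n) :
    simplicial_complex n :=
  SimplicialComplex (multineighbor_neq0 m G) (@multineighbor_sub m n G).

Definition gnp_mass (R : realType) (n : nat) (p : R) (G : graph n) : R :=
  \prod_(e : vertex_pair n) (if e \in G then p else 1 - p).

Definition gnp_prob (R : realType) (n : nat) (p : R) (A : graph n -> Prop) : R :=
  \sum_(G : graph n | `[< A G >]) gnp_mass p G.

Definition gnp_aas (R : realType) (p : nat -> R)
    (A : forall n, graph n -> Prop) : Prop :=
  (gnp_prob (p n) (@A n) @[n --> \oo] --> (1 : R))%classic.

(* Main.v *)
Require Import Defs.
From mathcomp Require Import all_boot all_order all_algebra.
From mathcomp Require Import ring_quotient ring lra.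
From mathcomp Require Import all_classical all_reals all_analysis.
From mathcomp Require Import finset.
Import Order.TTheory GRing.Theory Num.Theory.
Import numFieldNormedType.Exports.

Set Implicit Arguments.
Unset Strict Implicit.
Unset Printing Implicit Defensive.

Local Open Scope ring_scope.

(* Write [L = l + 2].  If every [L]-set [tau] of vertices has an apex [w], that
   is, [w |: (tau :\ v)] is a simplex for all [v] in [tau], then [H_l = 0]: a
   cycle [z] is the boundary of a cone, hence a combination of the spheres
   [bdry tau], and each of these is filled by coning it from an apex.

   Fix [tau] and split the other vertices into a set [A] and [L m] sets [B_(v,j)],
   [v] in [tau], [j < m], all of size of order [n].  The set [S_(v,j)] of common
   neighbors of [tau :\ v] in [B_(v,j)] has about [n p ^ (L - 1)] elements, by
   a Chernoff bound.  Given the [S_(v,j)], the vertices of [A] are independent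
   of each other, and each is adjacent to all the [S_(v,j)], hence is an apex,
   with probability bounded below, because [p |S_(v,j)|] is of order at least
   [n p ^ L >= 1].  So [tau] has no apex with probability exponentially small in
   [n p ^ (L - 1)], which is at least [n ^ (1 / L)], and a union bound over
   the [n ^ L] choices of [tau] concludes. *)

(** * Acyclicity from apexes *)

Definition eps (n : nat) (t : {set 'I_n}) (v : 'I_n) : int :=
  (-1) ^+ #|[set u in t | (u < v)%N]|.

(** The boundary on augmented chains of the full simplex, all degrees at once, read off coefficient
    by coefficient: [eps t v] is the sign of the facet [t] in [v |: t]. *)
Definition bdry (n : nat) (f : {set 'I_n} -> int) (t : {set 'I_n}) : int :=
  \sum_(v | v \notin t) eps t v * f (v |: t).

Definition cone (n : nat) (w : 'I_n) (f : {set 'I_n} -> int) (t : {set 'I_n}) : int :=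
  if w \in t then eps t w * f (t :\ w) else 0.

Lemma epsK n (t : {set 'I_n}) v : eps t v * eps t v = 1.
Proof. by rewrite -expr2 sqrr_sign. Qed.

Lemma epsU1 n (t : {set 'I_n}) (v w : 'I_n) : v \notin t ->
  eps (v |: t) w = (-1) ^+ (v < w)%N * eps t w.
Proof.
move=> vt; rewrite /eps -exprD; congr (_ ^+ _).
have [vw|vw] := boolP (v < w)%N.
  rewrite (_ : [set u in v |: t | _] = v |: [set u in t | (u < w)%N]).
    by rewrite cardsU1 inE (negbTE vt).
  by apply/setP => u; rewrite !inE; case: eqP => [->|]; rewrite ?vw.
rewrite add0n; congr #|pred_of_set _|; apply/setP => u; rewrite !inE.
by case: eqP => [->|]; rewrite ?(negbTE vw) ?andbF.
Qed.

Lemma epsU1_same n (t : {set 'I_n}) (v : 'I_n) : v \notin t ->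
  eps (v |: t) v = eps t v.
Proof. by move=> vt; rewrite epsU1 // ltnn mul1r. Qed.

Lemma sign_ltn_total n (v w : 'I_n) : v != w ->
  (-1) ^+ (v < w)%N = - (-1) ^+ (w < v)%N :> int.
Proof. by rewrite -val_eqE /=; case: ltngtP => // _ _; rewrite ?opprK. Qed.

(** Adding [v] before or after removing [w] differs by one sign, since exactly one of [v < w] and
    [w < v] holds. *)
Lemma eps_swap n (t : {set 'I_n}) (v w : 'I_n) : w \in t -> v \notin t ->
  eps t v * eps (v |: t) w = - (eps t w * eps (t :\ w) v).
Proof.
move=> wt vt; have vw : v != w by apply: contraNneq vt => ->.
have wtw : w \notin t :\ w by rewrite !inE eqxx.
rewrite -[t in eps t v](setD1K wt) !epsU1 // (sign_ltn_total vw).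
by rewrite mulNr mulrN mulrACA -expr2 sqrr_sign mul1r mulrC.
Qed.

(** Coning from [w] is a contracting homotopy. If [w] is not in [t], only the index [v = w] of the
    first term survives; otherwise [v = w] in the second term gives [f t] and all other indices
    cancel by [eps_swap]. *)
Lemma bdry_cone n (w : 'I_n) f t : bdry (cone w f) t + cone w (bdry f) t = f t.
Proof.
rewrite /bdry /cone; have [wt|wt] := boolP (w \in t); last first.
  rewrite addr0 (bigD1 w) //= [X in _ + X]big1 => [|v /andP[vt vw]].
    by rewrite addr0 setU11 epsU1_same // setU1K // mulrA epsK mul1r.
  by rewrite !inE (negbTE wt) eq_sym (negbTE vw) mulr0.
have wtw : w \notin t :\ w by rewrite !inE eqxx.
have ew : eps (t :\ w) w = eps t w by rewrite -{2}(setD1K wt) epsU1_same.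
rewrite (bigD1 (P := fun v => v \notin t :\ w) w) //=.
rewrite setD1K // mulrDr mulrA ew epsK mul1r.
rewrite addrCA [X in _ + X](_ : _ = 0) ?addr0 //.
rewrite big_distrr /= [X in _ + X](eq_bigl (fun v => v \notin t)) => [|v]; last first.
  by rewrite !inE; case: eqP => [->|]; rewrite ?wt ?andbF ?andbT.
rewrite -big_split /= big1 // => v vt.
have vw : v != w by apply: contraNneq vt => ->.
have vtw : v \notin t :\ w by rewrite !inE (negbTE vt) andbF.
rewrite inE wt orbT (_ : (v |: t) :\ w = v |: t :\ w); last first.
  by apply/setP => u; rewrite !inE; case: (eqVneq u v) => [->|]; rewrite ?vw.
by rewrite !mulrA eps_swap // mulNr addNr.
Qed.

Lemma bdry_bdry n (f : {set 'I_n} -> int) t : bdry (bdry f) t = 0.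
Proof.
(* Extending the summand by [0] lets both indices range over all vertices; [F] is then
   antisymmetric, so twice the sum vanishes, and [int] has no 2-torsion. *)
pose F u v := (if (v \notin t) && (u \notin v |: t)
  then eps t v * eps (v |: t) u * f (u |: (v |: t)) else 0).
have -> : bdry (bdry f) t = \sum_v \sum_u F u v.
  rewrite /bdry big_mkcond; apply: eq_bigr => v _ /=; rewrite /F.
  case: ifP => vt /=; last by rewrite big1.
  rewrite big_distrr /= [LHS]big_mkcond; apply: eq_bigr => u _.
  by case: ifP; rewrite ?mulrA.
have FN u v : F u v = - F v u.
  rewrite /F !inE !negb_or [v == u]eq_sym.
  case: (eqVneq u v) => [->|uv]; first by rewrite !andbF oppr0.
  rewrite /=; case: (boolP (u \in t)) => ut; case: (boolP (v \in t)) => vt;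
    rewrite ?andbF ?oppr0 //=.
  rewrite setUCA -mulNr; congr (_ * _).
  rewrite (epsU1 _ vt) (epsU1 _ ut) (sign_ltn_total uv).
  by rewrite !mulNr !mulrN opprK mulrCA [in RHS]mulrCA [eps t u * _]mulrC.
set S := \sum_v _.
have : S *+ 2 == 0.
  rewrite mulr2n {1}/S exchange_big -big_split big1 //= => u _.
  by rewrite -big_split big1 // => v _; rewrite /= FN addNr.
by rewrite mulrn_eq0 /= => /eqP.
Qed.

(** * Chains of a complex as chains of the full simplex *)

Section Complex.
Variables (n : nat) (K : simplicial_complex n).

(** Extension by [0] outside the faces makes [bdry] and [cone] applicable, even when a cone leaves
    [K]. *)
Definition extend k (c : chain K k) (s : {set 'I_n}) : int :=
  if insub s is Some s' then c s' else 0.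

Lemma extendE k (c : chain K k) (s : face K k) : extend c (val s) = c s.
Proof. by rewrite /extend valK. Qed.

Lemma extend_neq0 k (c : chain K k) s :
  extend c s != 0 -> ((s == set0) || (s \in simplices K)) && (#|s| == k).
Proof. by rewrite /extend; case: insubP => [s' -> //|]; rewrite eqxx. Qed.

Lemma bdryE (f : {set 'I_n} -> int) t :
  bdry f t = \sum_s f s * incidence s t.
Proof.
rewrite /bdry /incidence.
under [RHS]eq_bigr do rewrite big_distrr /= big_mkcondr /=.
rewrite (exchange_big_dep predT) //= big_mkcond; apply: eq_bigr => v _ /=.
case: ifPn => [vt|/negbNE vt]; last first.
  by rewrite big1 // => s vs; case: eqP => // st; rewrite -st !inE eqxx in vt.
rewrite (bigD1 (v |: t)) ?setU11 //= setU1K // eqxx.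
rewrite big1 ?addr0 => [|s /andP[vs sN]]; first by rewrite mulrC -(epsU1_same vt).
by case: eqP => // st; rewrite -st setD1K ?eqxx // in sN.
Qed.

Lemma boundaryE k (f : {set 'I_n} -> int) (t : face K k) :
  (forall s, f s != 0 -> ((s == set0) || (s \in simplices K)) && (#|s| == k.+1)) ->
  boundary [ffun s : face K k.+1 => f (val s)] t = bdry f (val t).
Proof.
move=> fK; rewrite bdryE ffunE.
under eq_bigr do rewrite ffunE.
pose P s := ((s == set0) || (s \in simplices K)) && (#|s| == k.+1).
rewrite (bigID P) /= [X in _ = _ + X]big1 ?addr0; last first.
  by move=> s /(contraNeq (fK s))->; rewrite mul0r.
exact: esym (big_sub P _).
Qed.

Lemma bdry_extend k (c : chain K k.+1) (t : face K k) :
  bdry (extend c) (val t) = boundary c t.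
Proof.
rewrite -boundaryE; last exact: extend_neq0.
by congr (boundary _ t); apply/ffunP => s; rewrite ffunE extendE.
Qed.

(** Off the faces of cardinality [l] the boundary vanishes as well: a simplex [v |: t] in the
    support would make [t] a face, [K] being closed under subsets. *)
Lemma bdry_extend_cycle l (c : Defs.cycle K l) t : bdry (extend c) t = 0.
Proof.
have [tK|tK] := boolP (((t == set0) || (t \in simplices K)) && (#|t| == l)).
  rewrite -[t](SubK (face K l) tK) bdry_extend.
  by have := cycle_valP c; rewrite inE => /eqP->; rewrite ffunE.
rewrite /bdry big1 // => v vt; have [->|] := eqVneq (extend c (v |: t)) 0.
  by rewrite mulr0.
move=> /extend_neq0 /andP[vtK]; rewrite cardsU1 vt eqSS => tl.
move: tK; rewrite tl andbT negb_or => /andP[t0].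
rewrite (simplices_sub (s := v |: t)) ?subsetUr //.
by case/orP: vtK => // /eqP /setP /(_ v); rewrite !inE eqxx.
Qed.

Lemma bdry_sum (I : finType) (a : I -> int) (g : I -> {set 'I_n} -> int) t :
  bdry (fun s => \sum_i a i * g i s) t = \sum_i a i * bdry (g i) t.
Proof.
rewrite /bdry; under eq_bigr do rewrite big_distrr /=.
rewrite exchange_big /=; apply: eq_bigr => i _; rewrite big_distrr /=.
by apply: eq_bigr => v _; rewrite mulrCA.
Qed.

Lemma sum_indicator (f : {set 'I_n} -> int) t :
  \sum_s f s * (t == s)%:R = f t.
Proof.
rewrite (bigD1 t) //= eqxx mulr1 big1 ?addr0 // => s /negbTE.
by rewrite eq_sym => ->; rewrite mulr0.
Qed.

Lemma bdry_indicator_neq0 (tau t : {set 'I_n}) :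
  bdry (fun s => (s == tau)%:R) t != 0 -> exists2 v, v \in tau & t = tau :\ v.
Proof.
move=> nz; have [/forall_inP vt|] := boolP [forall v in ~: t, v |: t != tau].
  rewrite /bdry big1 ?eqxx // in nz => v vN.
  by rewrite (negbTE (vt v _)) ?inE // mulr0.
rewrite negb_forall_in => /exists_inP[v]; rewrite inE negbK => vt /eqP <-.
by exists v; rewrite ?setU11 ?setU1K.
Qed.

Lemma reduced_homology_eq0 l (v0 : 'I_n) :
  (forall tau : {set 'I_n}, #|tau| = l.+2 ->
     exists w, forall v, v \in tau -> w |: (tau :\ v) \in simplices K) ->
  forall x : reduced_homology K l, x = 0.
Proof.
move=> fillK x; rewrite -[x]reprK; set z : Defs.cycle K l := repr x.
have {fillK} /boolp.choice[w wP] : forall tau : {set 'I_n}, exists w,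
    #|tau| = l.+2 -> forall v, v \in tau -> w |: (tau :\ v) \in simplices K.
  move=> tau; have [/fillK[w wP]|/eqP tauN] := eqVneq #|tau| l.+2; last by exists v0.
  by exists w.
(* As [z] is a cycle, the homotopy formula gives [bdry y = z]; but [y] may use sets that are not
   simplices of [K]. *)
pose y := cone v0 (extend z).
pose delta (tau s : {set 'I_n}) : int := (s == tau)%:R.
(* Each [tau] in [y] is replaced by the cone over its boundary sphere from the apex [w tau]. The
   boundary is unchanged, because [bdry_bdry] kills the other homotopy term. *)
pose d t := \sum_tau y tau * cone (w tau) (bdry (delta tau)) t.
have dK t : d t != 0 -> ((t == set0) || (t \in simplices K)) && (#|t| == l.+2).
  move=> dt; have [/forallP tau0|] :=
    boolP [forall tau, y tau * cone (w tau) (bdry (delta tau)) t == 0].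
    by rewrite /d big1 ?eqxx // in dt => tau _; apply/eqP.
  rewrite negb_forall => /existsP[tau]; rewrite mulf_eq0 negb_or => /andP[].
  rewrite /y {1}/cone; case: ifPn => [v0tau|]; last by rewrite eqxx.
  rewrite mulf_eq0 negb_or => /andP[_ /extend_neq0 /andP[_ /eqP card_tau]].
  have {v0tau}card_tau : #|tau| = l.+2 by rewrite (cardsD1 v0) v0tau card_tau.
  rewrite /cone; case: ifPn => [wt|]; last by rewrite eqxx.
  rewrite mulf_eq0 negb_or => /andP[_ /bdry_indicator_neq0[v vtau tE]].
  rewrite -(setD1K wt) tE wP // orbT /= -tE setD1K //.
  by rewrite (cardsD1 (w tau)) wt tE -card_tau [X in _ == X](cardsD1 v) vtau.
(* The class of [z] is zero once [z] itself is a boundary, and [d] restricted to the faces is the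
   witness. *)
apply/eqP; rewrite piE /= /Quotient.equiv subr0; apply/asboolP.
exists [ffun s : face K l.+2 => d (val s)]; apply/ffunP => t.
rewrite boundaryE // /d bdry_sum -extendE.
under eq_bigr => tau _.
  have := bdry_cone (w tau) (bdry (delta tau)) (val t).
  rewrite {2}/cone bdry_bdry mulr0 if_same addr0 => ->.
  over.
rewrite -bdry_sum /bdry; under eq_bigr do rewrite sum_indicator.
rewrite -/(bdry y (val t)); have := bdry_cone v0 (extend z) (val t).
by rewrite [X in _ + X]/cone bdry_extend_cycle mulr0 if_same addr0.
Qed.

End Complex.

(** * Independence in the random graph *)

Lemma natr_forall_in (R : realType) (I : finType) (A : {pred I}) (P : pred I) :
  [forall i in A, P i]%:R = \prod_(i in A) (P i)%:R :> R.
Proof.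
case: forall_inP => [AP|nAP]; first by rewrite big1 // => i /AP->.
have [i iA /negbTE nPi] : exists2 i, i \in A & ~~ P i.
  by apply/exists_inP; rewrite -negb_forall_in; apply/forall_inP.
by rewrite (bigD1 i) //= nPi mul0r.
Qed.

Lemma natr_negb (R : realType) (b : bool) : (~~ b)%:R = 1 - b%:R :> R.
Proof. by case: b; rewrite ?subrr ?subr0. Qed.

Section RandomGraph.
Variables (R : realType) (n : nat) (p : R).
Hypothesis p01 : 0 <= p <= 1.

Implicit Types (G H : graph n) (D : {set vertex_pair n}) (X Y : {set 'I_n}).

Definition gnp_mean (f : graph n -> R) : R := \sum_G gnp_mass p G * f G.

Lemma gnp_mass_ge0 G : 0 <= gnp_mass p G.
Proof.
case/andP: p01 => p0 p1; apply: prodr_ge0 => e _.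
by case: ifP; rewrite ?subr_ge0.
Qed.

Lemma le_gnp_mean f g : (forall G, f G <= g G) -> gnp_mean f <= gnp_mean g.
Proof. by move=> fg; apply: ler_sum => G _; rewrite ler_wpM2l ?gnp_mass_ge0. Qed.

Lemma gnp_mean_ext f g : f =1 g -> gnp_mean f = gnp_mean g.
Proof. by move=> fg; apply: eq_bigr => G _; rewrite fg. Qed.

Lemma gnp_meanZ c f : gnp_mean (fun G => c * f G) = c * gnp_mean f.
Proof. by rewrite /gnp_mean big_distrr; apply: eq_bigr => G _; rewrite /= mulrCA. Qed.

Lemma gnp_meanD f g : gnp_mean (fun G => f G + g G) = gnp_mean f + gnp_mean g.
Proof. by rewrite /gnp_mean -big_split; apply: eq_bigr => G _; rewrite /= mulrDr. Qed.

Lemma gnp_mean_sum (I : finType) (P : pred I) (f : I -> graph n -> R) :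
  gnp_mean (fun G => \sum_(i | P i) f i G) = \sum_(i | P i) gnp_mean (f i).
Proof.
by rewrite /gnp_mean exchange_big; apply: eq_bigr => G _; rewrite /= big_distrr.
Qed.

Lemma gnp_mean1 : gnp_mean (fun=> 1) = 1.
Proof.
rewrite /gnp_mean; under eq_bigr do rewrite mulr1 /gnp_mass.
(* Expanding the product of the factors [p + (1 - p)] over all pairs yields the sum of all
   masses. *)
rewrite -(@bigA_distr R 0 1 _ _ _ (fun=> p) (fun=> 1 - p)).
by rewrite big1 // => e _; rewrite /= addrC subrK.
Qed.

Lemma gnp_mean_cst c : gnp_mean (fun=> c) = c.
Proof. by rewrite -[in LHS](mulr1 c) gnp_meanZ gnp_mean1 mulr1. Qed.

Lemma gnp_mean_onem f : gnp_mean (fun G => 1 - f G) = 1 - gnp_mean f.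
Proof.
rewrite -[X in X - _]gnp_mean1 -mulN1r -gnp_meanZ -gnp_meanD.
by apply: gnp_mean_ext => G; rewrite mulN1r.
Qed.

(** Keeps [G] on [D] and takes [H] elsewhere. With [H] an independent copy of [G], this expresses
    conditioning on the edges in [D]. *)
Definition resample D G H : graph n := (G :&: D) :|: (H :\: D).

(* [(G, H) |-> (resample D G H, resample D H G)] is a mass-preserving involution. *)
Lemma gnp_mean_resample D f :
  gnp_mean f = gnp_mean (fun G => gnp_mean (fun H => f (resample D G H))).
Proof.
pose swap (q : graph n * graph n) := (resample D q.1 q.2, resample D q.2 q.1).
have swapK : involutive swap.
  by move=> [G H]; rewrite /swap /resample /=; congr pair;
    apply/setP => e; rewrite !inE; case: (e \in D); rewrite ?(andbF, andbT, orbF).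
have massE G H : gnp_mass p (resample D G H) * gnp_mass p (resample D H G) =
    gnp_mass p G * gnp_mass p H.
  rewrite /gnp_mass -!big_split; apply: eq_bigr => e _ /=; rewrite !inE.
  by case: (e \in D); rewrite ?(andbF, andbT, orbF) //= mulrC.
rewrite /gnp_mean.
under [RHS]eq_bigr do rewrite big_distrr /=.
rewrite pair_big /= (reindex_inj (inv_inj swapK)) /=.
under [RHS]eq_bigr => q _.
  rewrite mulrA massE (_ : resample D _ _ = q.1); last exact: (congr1 fst (swapK q)).
  over.
rewrite -(pair_big xpredT xpredT (fun G H => gnp_mass p G * gnp_mass p H * f G)) /=.
apply: eq_bigr => G _; rewrite -[LHS]mulr1 -gnp_mean1 /gnp_mean big_distrr /=.
by apply: eq_bigr => H _; rewrite mulr1 mulrAC.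
Qed.

(** Measurability with respect to the edges in [D]. *)
Definition depends_on (T : Type) D (f : graph n -> T) := forall G, f (G :&: D) = f G.

Lemma depends_on_sub T D D' (f : graph n -> T) :
  D \subset D' -> depends_on D f -> depends_on D' f.
Proof. by move=> sDD' fD G; rewrite -fD -setIA (setIidPr sDD') fD. Qed.

(** After resampling outside [D], the factor [f] sees only [G] and [g] sees only [H], so the double
    mean factors. *)
Lemma gnp_meanM D D' f g : [disjoint D & D'] ->
  depends_on D f -> depends_on D' g ->
  gnp_mean (fun G => f G * g G) = gnp_mean f * gnp_mean g.
Proof.
move=> DD' fD gD'; rewrite (gnp_mean_resample D).
rewrite mulrC -gnp_meanZ; apply: gnp_mean_ext => G.
rewrite mulrC -gnp_meanZ; apply: gnp_mean_ext => H.
rewrite -fD -[g (resample _ _ _)]gD' -[f G]fD -[g H]gD'.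
congr (f _ * g _); apply/setP => e; rewrite !inE.
  by case: (e \in D); rewrite ?(andbF, andbT, orbF).
by case: (boolP (e \in D)) => eD; rewrite ?(disjointFr DD' eD) ?(andbF, andbT, orbF).
Qed.

Lemma depends_on_prod (I : eqType) (r : seq I) D (f : I -> graph n -> R) :
  (forall i, i \in r -> depends_on D (f i)) ->
  depends_on D (fun G => \prod_(i <- r) f i G).
Proof. by move=> fD G; apply: eq_big_seq => i ir; rewrite fD. Qed.

(** Induction on an enumeration of [A]: the remaining product depends on the union of the remaining
    [D j], which is disjoint from [D i]. *)
Lemma gnp_mean_prod (I : finType) (A : {pred I}) (D : I -> {set vertex_pair n})
    (f : I -> graph n -> R) :
  {in A &, forall i j, i != j -> [disjoint D i & D j]} ->
  {in A, forall i, depends_on (D i) (f i)} ->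
  gnp_mean (fun G => \prod_(i in A) f i G) = \prod_(i in A) gnp_mean (f i).
Proof.
move=> Ddisj fD; under gnp_mean_ext do rewrite -big_enum /=.
rewrite -big_enum; have : uniq (enum A) by exact: enum_uniq.
have : {subset enum A <= A} by move=> i; rewrite mem_enum.
elim: (enum A) => [|i r IH] rA /=.
  by rewrite big_nil -[RHS]gnp_mean1 => _; apply: gnp_mean_ext => G; rewrite big_nil.
move=> /andP[ir ur]; rewrite big_cons -IH //; last first.
  by move=> j jr; apply: rA; rewrite inE jr orbT.
under gnp_mean_ext do rewrite big_cons.
have iA : i \in A by apply: rA; rewrite mem_head.
apply: (gnp_meanM (D := D i) (D' := \bigcup_(j in [set j in r]) D j)) (fD i iA) _.
  apply/bigcup_disjointP => j; rewrite inE => jr.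
  rewrite Ddisj //; first by apply: rA; rewrite inE jr orbT.
  by apply: contraNneq ir => ->.
apply: depends_on_prod => j jr.
apply: (depends_on_sub (D := D j)); last by apply: fD; apply: rA; rewrite inE jr orbT.
by apply: bigcup_sup; rewrite inE.
Qed.

(** * Edges between two vertex sets *)

Definition edges_between X Y : {set vertex_pair n} :=
  [set e | [exists u in X, [exists v in Y, val e == [set u; v]]]].

Lemma edges_betweenP X Y (e : vertex_pair n) :
  reflect (exists2 u, u \in X & exists2 v, v \in Y & val e = [set u; v])
          (e \in edges_between X Y).
Proof.
rewrite inE; apply: (iffP exists_inP) => -[u uX]; last first.
  by move=> [v vY eE]; exists u => //; apply/exists_inP; exists v => //; apply/eqP.
by move=> /exists_inP[v vY /eqP eE]; exists u => //; exists v.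
Qed.

Lemma set2_inj (T : finType) (X Y : {set T}) (u v u' v' : T) : [disjoint X & Y] ->
  u \in X -> u' \in X -> v \in Y -> v' \in Y ->
  [set u; v] = [set u'; v'] -> u = u' /\ v = v'.
Proof.
move=> XY uX u'X vY v'Y /setP E; split.
  have := E u; rewrite !inE eqxx /= => /esym/orP[/eqP //|/eqP uv'].
  by rewrite uv' (disjointFl XY v'Y) in uX.
have := E v; rewrite !inE eqxx orbT /= => /esym/orP[/eqP vu'|/eqP //].
by rewrite vu' (disjointFr XY u'X) in vY.
Qed.

(** As the two sides are disjoint, an edge determines its endpoint on each side; a shared edge would
    give a common point of [X] and [X'] and one of [Y] and [Y']. *)
Lemma edges_between_disjoint X X' Y Y' : [disjoint X :|: X' & Y :|: Y'] ->
  [disjoint X & X'] || [disjoint Y & Y'] ->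
  [disjoint edges_between X Y & edges_between X' Y'].
Proof.
move=> XY XX'; rewrite disjoint_subset.
apply/fintype.subsetP => e /edges_betweenP[u uX [v vY eE]].
rewrite inE; apply/negP => /edges_betweenP[u' uX' [v' vY' eE']].
have [] := @set2_inj _ _ _ u v u' v' XY _ _ _ _ (etrans (esym eE) eE');
  rewrite ?inE ?uX ?vY ?uX' ?vY' ?orbT // => uu vv; subst.
by case/orP: XX' => /disjointFr; [move/(_ _ uX)|move/(_ _ vY)]; rewrite ?uX' ?vY'.
Qed.

Lemma depends_on_edge_rel X Y u v : u \in X -> v \in Y ->
  depends_on (edges_between X Y) (fun G => edge_rel G u v).
Proof.
move=> uX vY G; apply: eq_existsb => e; rewrite inE.
have [eE|] := eqVneq (val e) [set u; v]; rewrite ?andbF //.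
rewrite (_ : e \in edges_between X Y) ?andbT //.
by apply/edges_betweenP; exists u => //; exists v.
Qed.

Lemma gnp_mean_edge u v : u != v -> gnp_mean (fun G => (edge_rel G u v)%:R) = p.
Proof.
move=> uv; have card2 : #|[set u; v]| == 2%N by rewrite cards2 uv.
pose e : vertex_pair n := Sub [set u; v] card2.
have edgeE G : edge_rel G u v = (e \in G).
  apply/exists_inP/idP => [[e' e'G /eqP e'E]|eG]; last by exists e.
  by rewrite (_ : e = e') //; apply: val_inj; rewrite e'E.
under gnp_mean_ext do rewrite edgeE.
(* Giving the absence of [e] weight [0] absorbs the indicator of [e] into a product over pairs, to
   which distributivity applies. *)
pose q e' : R := if e' == e then 0 else 1 - p.
rewrite /gnp_mean (_ : \sum_G _ =
  \sum_(G : graph n) \prod_e' (if e' \in G then p else q e')).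
  rewrite -(@bigA_distr R 0 1 _ _ _ (fun=> p) q) (bigD1 e) //= /q eqxx addr0.
  rewrite big1 ?mulr1 // => e' /negbTE->.
  by rewrite addrC subrK.
apply: eq_bigr => G _; rewrite /gnp_mass; have [eG|eG] := boolP (e \in G).
  rewrite mulr1; apply: eq_bigr => e' _; case: ifP => // e'G; rewrite /q.
  by case: eqP e'G => // ->; rewrite eG.
by rewrite mulr0 [RHS](bigD1 e) //= /q (negbTE eG) eqxx mul0r.
Qed.


Definition hits (w : 'I_n) (S : {set 'I_n}) G := [exists b in S, edge_rel G w b].

Lemma hitsE w (S : {set 'I_n}) G :
  (hits w S G)%:R = 1 - \prod_(b in S) (1 - (edge_rel G w b)%:R) :> R.
Proof.
rewrite -[hits _ _ _]negbK natr_negb negb_exists_in natr_forall_in.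
by congr (1 - _); apply: eq_bigr => b _; rewrite natr_negb.
Qed.

Lemma depends_on_hits X Y w (S : {set 'I_n}) : w \in X -> S \subset Y ->
  depends_on (edges_between X Y) (hits w S).
Proof.
move=> wX /fintype.subsetP SY G; apply: eq_existsb => b.
by case: (boolP (b \in S)) => //= /SY bY; rewrite (depends_on_edge_rel wX bY).
Qed.

Lemma gnp_mean_hits w (S : {set 'I_n}) : w \notin S ->
  gnp_mean (fun G => (hits w S G)%:R) = 1 - (1 - p) ^+ #|S|.
Proof.
move=> wS; under gnp_mean_ext do rewrite hitsE.
rewrite gnp_mean_onem (gnp_mean_prod (D := fun b => edges_between [set w] [set b])).
- rewrite (eq_bigr (fun=> 1 - p)) ?prodr_const // => b bS.
  by rewrite gnp_mean_onem gnp_mean_edge //; apply: contraNneq wS => ->.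
- move=> b b' bS b'S bb'; apply: edges_between_disjoint; last first.
    by rewrite orbC disjoints1 inE bb'.
  rewrite setUid disjoints1 !inE negb_or.
  by apply/andP; split; apply: contraNneq wS => ->.
- by move=> b bS G; rewrite (depends_on_edge_rel (X := [set w]) (Y := [set b])) ?inE.
Qed.

(** Here the [S i] are fixed. Independence is used twice: between the vertices [w] of [A], and for
    one [w] between the disjoint sets [S i]. *)
Lemma gnp_mean_miss (I : finType) (A : {set 'I_n}) (S : I -> {set 'I_n}) :
  (forall i j, i != j -> [disjoint S i & S j]) ->
  (forall i, [disjoint A & S i]) ->
  gnp_mean (fun G => [forall w in A, ~~ [forall i, hits w (S i) G]]%:R) =
  (1 - \prod_i (1 - (1 - p) ^+ #|S i|)) ^+ #|A|.
Proof.
move=> Sdisj AS; pose U := \bigcup_i S i.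
have AU : [disjoint A & U] by apply/bigcup_disjointP.
have SU i : S i \subset U by apply: bigcup_sup.
under gnp_mean_ext do rewrite natr_forall_in.
rewrite (gnp_mean_prod (D := fun w => edges_between [set w] U)).
- rewrite -prodr_const; apply: eq_bigr => w wA.
  under gnp_mean_ext do rewrite natr_negb.
  rewrite gnp_mean_onem; congr (1 - _).
  under gnp_mean_ext => G.
    rewrite (_ : [forall i, _] = [forall i in I, hits w (S i) G]); last by [].
    rewrite natr_forall_in; over.
  rewrite (gnp_mean_prod (D := fun i => edges_between [set w] (S i))).
  + apply: eq_bigr => i _; rewrite gnp_mean_hits //.
    by rewrite (disjointFr (AS i) wA).
  + move=> i j _ _ ij; apply: edges_between_disjoint; last by rewrite Sdisj ?orbT.
    by rewrite setUid disjoints1 !inE !(disjointFr (AS _) wA).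
  + by move=> i _ G; rewrite (depends_on_hits (X := [set w]) (Y := S i)) ?inE.
- move=> w w' wA w'A ww'; apply: edges_between_disjoint.
    rewrite setUid; apply: disjointWl AU.
    by rewrite subUset !sub1set wA w'A.
  by rewrite disjoints1 inE ww'.
- move=> w wA G; congr ((~~ _)%:R); apply: eq_forallb => i.
  by rewrite (depends_on_hits (X := [set w]) (Y := U)) ?inE.
Qed.

Definition common_in (sigma B : {set 'I_n}) G : {set 'I_n} :=
  B :&: common_neighbors G sigma.

(* Markov's inequality for [2 ^- #|common_in sigma B G|], a product of
   independent factors. *)
Lemma gnp_mean_few_common (sigma B : {set 'I_n}) (k : nat) : [disjoint sigma & B] ->
  gnp_mean (fun G => (#|common_in sigma B G| < k)%N%:R) <=
  2 ^+ k * (1 - p ^+ #|sigma| / 2) ^+ #|B|.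
Proof.
move=> sB.
(* [h G b] is [1/2] when [b] is adjacent to all of [sigma] and [1] otherwise. *)
pose h G (b : 'I_n) : R := 1 - \prod_(u in sigma) (edge_rel G u b)%:R / 2.
have hE G : \prod_(b in B) h G b = 2 ^- #|common_in sigma B G|.
  rewrite /common_in (big_setID (common_neighbors G sigma)) /= [X in _ * X]big1 ?mulr1.
    rewrite (eq_bigr (fun=> 2^-1)) ?prodr_const ?exprVn // => b.
    rewrite !inE => /andP[_ /forall_inP bs].
    rewrite /h -natr_forall_in (_ : [forall _ in _, _]); last by apply/forall_inP.
    by rewrite /= mulr1n; lra.
  move=> b; rewrite !inE => /andP[nb _].
  by rewrite /h -natr_forall_in (negbTE nb) mul0r subr0.
apply: (@le_trans _ _ (gnp_mean (fun G => 2 ^+ k * \prod_(b in B) h G b))).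
  apply: le_gnp_mean => G; rewrite hE; case: ltnP => [lt_k|_].
    rewrite /= mulr1n ler_pdivlMr; last by rewrite exprn_gt0.
    by rewrite mul1r; apply: ler_weXn2l; [rewrite ler1n|exact: ltnW].
  by rewrite /= mulr0n divr_ge0 // exprn_ge0.
rewrite gnp_meanZ (gnp_mean_prod (D := fun b => edges_between sigma [set b])).
- rewrite ler_wpM2l ?exprn_ge0 // (eq_bigr (fun=> 1 - p ^+ #|sigma| / 2)) ?prodr_const //.
  move=> b bB; rewrite gnp_mean_onem /=.
  under gnp_mean_ext do rewrite mulrC.
  rewrite gnp_meanZ mulrC; congr (1 - _ / 2).
  have bs : b \notin sigma by rewrite (disjointFl sB bB).
  rewrite (gnp_mean_prod (D := fun u => edges_between [set u] [set b])).
  + rewrite (eq_bigr (fun=> p)) ?prodr_const // => u us.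
    by rewrite gnp_mean_edge //; apply: contraNneq bs => <-.
  + move=> u u' us u's uu'; apply: edges_between_disjoint.
      rewrite setUid disjoint_sym disjoints1 !inE negb_or.
      by apply/andP; split; apply: contraNneq bs => ->.
    by rewrite disjoints1 inE uu'.
  + by move=> u us G; rewrite (depends_on_edge_rel (X := [set u]) (Y := [set b])) ?inE.
- move=> b b' bB b'B bb'; apply: edges_between_disjoint.
    by rewrite setUid; apply: disjointWr sB; rewrite subUset !sub1set bB b'B.
  by rewrite orbC disjoints1 inE bb'.
- move=> b bB G; rewrite /h; congr (1 - _ / 2); apply: eq_bigr => u us.
  by rewrite (depends_on_edge_rel (X := sigma) (Y := [set b])) ?inE.
Qed.

Lemma edge_rel_resample X Y G H u v :
  edge_rel (resample (edges_between X Y) G H) u v =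
  if (u \in X) && (v \in Y) || (v \in X) && (u \in Y)
  then edge_rel G u v else edge_rel H u v.
Proof.
have DE (e : vertex_pair n) : val e = [set u; v] ->
    (e \in edges_between X Y) = ((u \in X) && (v \in Y) || (v \in X) && (u \in Y)).
  move=> eE; apply/edges_betweenP/idP => [[u' u'X [v' v'Y]]|].
    rewrite eE => E; have := set21 u' v'; have := set22 u' v'; rewrite -E.
    have := set21 u v; have := set22 u v; rewrite {1 2}E !inE.
    by do 4!move=> /orP[] /eqP ?; subst; rewrite ?u'X ?v'Y ?orbT.
  case/orP => /andP[]; first by exists u => //; exists v.
  by exists v => //; exists u => //; rewrite eE setUC.
rewrite /edge_rel; case: ifP => uv; apply: eq_existsb => e;
  case: (eqVneq (val e) [set u; v]) => [/DE eD|]; rewrite ?andbF // !andbT;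
  by rewrite /resample in_setU in_setI in_setD eD uv ?(andbF, andbT, orbF).
Qed.

(** Two rounds of exposure: the edges between [tau] and the [B i] determine the sets [common_in],
    and the edges leaving [A] are still fresh. Either some set has fewer than [k] elements, which a
    union bound controls, or [gnp_mean_miss] applies. *)
Lemma gnp_mean_no_apex (I : finType) (tau A : {set 'I_n}) (sigma B : I -> {set 'I_n}) k :
  (forall i j, i != j -> [disjoint B i & B j]) ->
  (forall i, [disjoint A & B i]) -> [disjoint A & tau] ->
  (forall i, [disjoint tau & B i]) ->
  (forall i, sigma i \subset tau) ->
  gnp_mean (fun G =>
    [forall w in A, ~~ [forall i, hits w (common_in (sigma i) (B i) G) G]]%:R) <=
  \sum_i 2 ^+ k * (1 - p ^+ #|sigma i| / 2) ^+ #|B i| +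
  (1 - (1 - (1 - p) ^+ k) ^+ #|I|) ^+ #|A|.
Proof.
move=> Bdisj AB Atau tauB sigma_tau; pose U := \bigcup_i B i.
have BU i : B i \subset U by apply: bigcup_sup.
have AU : [disjoint A & U] by apply/bigcup_disjointP.
have tauU : [disjoint tau & U] by apply/bigcup_disjointP.
rewrite (gnp_mean_resample (edges_between tau U)).
pose few G i := (#|common_in (sigma i) (B i) G| < k)%N.
set c := (X in _ + X).
apply: (@le_trans _ _ (gnp_mean (fun G => \sum_i (few G i)%:R + c))); last first.
  rewrite gnp_meanD gnp_mean_cst lerD2r gnp_mean_sum.
  apply: ler_sum => i _; apply: gnp_mean_few_common.
  by apply: disjointWl (tauB i); apply: sigma_tau.
case/andP: p01 => p0 p1.
have q01 j : 0 <= 1 - (1 - p) ^+ j <= 1.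
  by rewrite subr_ge0 exprn_ile1 ?subr_ge0 ?gerBl //= exprn_ge0 ?subr_ge0.
have c0 : 0 <= c.
  by rewrite exprn_ge0 // subr_ge0 exprn_ile1 //; case/andP: (q01 k).
apply: le_gnp_mean => G; have [/existsP[i fi]|] := boolP [exists i, few G i].
  apply: (@le_trans _ _ 1); last first.
    rewrite (bigD1 i) //= fi -addrA lerDl addr_ge0 // sumr_ge0 //.
  rewrite -[leRHS]gnp_mean1; apply: le_gnp_mean => H.
  by rewrite lern1 leq_b1.
rewrite negb_exists => /forallP fG.
rewrite big1 ?add0r => [|i _]; last by rewrite (negbTE (fG i)).
have SE i H : common_in (sigma i) (B i) (resample (edges_between tau U) G H) =
    common_in (sigma i) (B i) G.
  apply/setP => b; rewrite !inE; case: (boolP (b \in B i)) => //= bB.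
  apply: eq_forallb => u; case: (boolP (u \in sigma i)) => //= us.
  by rewrite edge_rel_resample (fintype.subsetP (sigma_tau i)) //
    (fintype.subsetP (BU i)).
(* A vertex [w] of [A] lies neither in [tau] nor in [U], so its edges are read from [H], while the
   sets to be hit come from [G] alone. *)
under gnp_mean_ext => H.
  rewrite (_ : [forall w in A, _] =
    [forall w in A, ~~ [forall i, hits w (common_in (sigma i) (B i) G) H]]); last first.
    apply: eq_forallb => w; case: (boolP (w \in A)) => //= wA; congr (~~ _).
    apply: eq_forallb => i; rewrite SE; apply: eq_existsb => b.
    rewrite edge_rel_resample (disjointFr Atau wA) (disjointFr AU wA).
    by rewrite andbF.
  over.
rewrite gnp_mean_miss.
- rewrite /c lerXn2r ?nnegrE ?subr_ge0 //.
  + by rewrite prodr_ile1 // => i _; apply: q01.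
  + by rewrite exprn_ile1 //; case/andP: (q01 k).
  + rewrite lerD2l lerN2 -prodr_const; apply: ler_prod => i _.
    case/andP: (q01 k) => -> _ /=; rewrite lerD2l lerN2 ler_wiXn2l ?subr_ge0 ?gerBl //.
    by rewrite leqNgt; apply: fG.
- move=> i j ij; apply: disjointW (Bdisj i j ij); exact: subsetIl.
- move=> i; apply: disjointWr (AB i); exact: subsetIl.
Qed.

End RandomGraph.

(** * Finding apexes *)

Definition filling_apex (m n : nat) (G : graph n) (tau : {set 'I_n}) (w : 'I_n) :=
  [forall v in tau, w |: (tau :\ v) \in multineighbor_simplices m G].

(* Each of the [m] disjoint sets [B (i, j)], [j : 'I_m], contributes a common
   neighbor of [w] and the [i]-th facet of [tau]. *)
Lemma hits_filling_apex (m n : nat) (G : graph n) (tau : {set 'I_n}) (w : 'I_n)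
    (B : 'I_#|tau| * 'I_m -> {set 'I_n}) :
  (forall i j, i != j -> [disjoint B i & B j]) ->
  (forall i, hits w (common_in (tau :\ enum_val i.1) (B i) G) G) ->
  filling_apex m G tau w.
Proof.
move=> Bdisj hitB; apply/forall_inP => v vtau; rewrite inE.
apply/andP; split; first by apply/set0Pn; exists w; rewrite setU11.
pose i := enum_rank_in vtau v.
have /fin_all_exists[b bP] : forall j : 'I_m, exists b,
    (b \in common_in (tau :\ v) (B (i, j)) G) && edge_rel G w b.
  by move=> j; have /existsP := hitB (i, j); rewrite /= enum_rankK_in.
have b_inj : injective b.
  move=> j j' bb; apply/eqP/negP => /negP jj'.
  have /disjointFr : [disjoint B (i, j) & B (i, j')].
    by apply: Bdisj; rewrite xpair_eqE eqxx.
  have := bP j; rewrite !inE => /andP[/andP[bj _] _] /(_ _ bj).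
  by have := bP j'; rewrite -bb !inE => /andP[/andP[-> _] _].
rewrite -[X in (X <= _)%N]card_ord -(card_imset _ b_inj).
apply/subset_leq_card/fintype.subsetP => _ /imsetP[j _ ->].
have := bP j; rewrite !inE => /andP[/andP[_ /forall_inP bs] bw].
by apply/forall_inP => u; rewrite in_setU1 => /predU1P[->|/bs].
Qed.

(** * Cutting the vertices into blocks and the union bound *)

Definition block (n s k : nat) : {set 'I_n} := [set v : 'I_n | (v %/ s == k)%N].

Lemma block_disjoint n s k k' : k != k' -> [disjoint block n s k & block n s k'].
Proof.
move=> kk'; rewrite disjoint_subset; apply/fintype.subsetP => v; rewrite !inE => /eqP->.
exact: kk'.
Qed.

Lemma card_block n s k : (k.+1 * s <= n)%N -> (s <= #|block n s k|)%N.
Proof.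
move=> ksn; have lt_n (i : 'I_s) : (k * s + i < n)%N.
  by apply: leq_trans ksn; rewrite mulSn addnC ltn_add2r.
have inj : injective (fun i => Ordinal (lt_n i)).
  by move=> i j [] /addnI /val_inj.
rewrite -[X in (X <= _)%N]card_ord -(card_imset _ inj).
apply/subset_leq_card/fintype.subsetP => _ /imsetP[i _ ->]; rewrite inE /=.
by rewrite divnMDl ?(leq_ltn_trans _ (ltn_ord i)) // divn_small ?addn0.
Qed.

Lemma leq_bin_expn n k : ('C(n, k) <= n ^ k)%N.
Proof.
apply: (@leq_trans (n ^_ k)); first by rewrite -bin_ffact leq_pmulr ?fact_gt0.
rewrite ffact_prod -[X in (_ <= _ ^ X)%N]card_ord -prod_nat_const.
by apply: leq_prod => i _; rewrite leq_subr.
Qed.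

Section NoApex.
Variables (R : realType) (n : nat) (p : R).
Hypothesis p01 : 0 <= p <= 1.

Lemma gnp_mean_no_filling_apex (m k s : nat) (tau : {set 'I_n}) :
  (s <= n %/ (#|tau| * m).+1 - #|tau|)%N ->
  gnp_mean p (fun G => (~~ [exists w, filling_apex m G tau w])%:R) <=
  (#|tau| * m)%:R * (2 ^+ k * (1 - p ^+ #|tau|.-1 / 2) ^+ s) +
  (1 - (1 - (1 - p) ^+ k) ^+ (#|tau| * m)) ^+ s.
Proof.
set c := (#|tau| * m)%N => s_le; pose q := (n %/ c.+1)%N.
pose I : finType := ('I_#|tau| * 'I_m)%type.
have cardI : #|{: I}| = c by rewrite card_prod !card_ord.
(* Of the [c.+1] blocks of length [q], the first [c] give the [B i] and the last gives [A]; removing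
   [tau] costs each at most [#|tau|] vertices. *)
pose B (i : I) := block n q (enum_rank i) :\: tau.
pose A := block n q c :\: tau.
have rank_c (i : I) : (enum_rank i < c)%N by rewrite -cardI.
have subD (X : {set 'I_n}) : X :\: tau \subset X by exact: subsetDl.
have Bdisj i j : i != j -> [disjoint B i & B j].
  move=> ij; apply: (disjointW (subD _) (subD _)); apply: block_disjoint.
  by rewrite (inj_eq val_inj) (inj_eq enum_rank_inj).
have card_ge j : (j <= c)%N -> (s <= #|block n q j :\: tau|)%N.
  move=> jc; rewrite (leq_trans s_le) // cardsD leq_sub //.
    apply/card_block/(@leq_trans (c.+1 * q)); first by rewrite leq_mul2r ltnS jc orbT.
    by rewrite mulnC leq_divM.
  by rewrite subset_leq_card ?subsetIr.
have tauN (X : {set 'I_n}) : [disjoint tau & X :\: tau].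
  by rewrite -setI_eq0 setDE setICA setICr setI0.
case/andP: p01 => p0 p1.
have q01 e : 0 <= p ^+ e <= 1 by rewrite exprn_ge0 ?exprn_ile1.
have r01 j : 0 <= 1 - (1 - p) ^+ j <= 1.
  by rewrite subr_ge0 exprn_ile1 ?subr_ge0 ?gerBl //= exprn_ge0 ?subr_ge0.
apply: (le_trans (le_gnp_mean p01 (g := fun G =>
    [forall w in A,
      ~~ [forall i, hits w (common_in (tau :\ enum_val i.1) (B i) G) G]]%:R) _)).
  move=> G; rewrite ler_nat; case: existsP => //= nw.
  rewrite lt0b; apply/forall_inP => w _; apply/negP => /forallP hw; apply: nw.
  by exists w; exact: (hits_filling_apex Bdisj hw).
apply: (le_trans (gnp_mean_no_apex p01 (tau := tau) k Bdisj _ _ _ _)).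
- move=> i; apply: (disjointW (subD _) (subD _)); apply: block_disjoint.
  by rewrite gtn_eqF.
- by rewrite disjoint_sym tauN.
- by move=> i; apply: tauN.
- by move=> i; apply: subD1set.
rewrite cardI lerD //.
  rewrite mulr_natl -cardI -sumr_const; apply: ler_sum => i _.
  rewrite ler_wpM2l ?exprn_ge0 //.
  have -> : #|tau :\ enum_val i.1| = #|tau|.-1.
    by rewrite [in RHS](cardsD1 (enum_val i.1)) enum_valP.
  have := q01 #|tau|.-1 => q01'.
  apply: ler_wiXn2l; [by lra|by lra|]; exact/card_ge/ltnW.
apply: ler_wiXn2l; [| |exact: card_ge].
  by rewrite subr_ge0 exprn_ile1 //; case/andP: (r01 k).
by rewrite gerBl exprn_ge0 //; case/andP: (r01 k).
Qed.

Lemma gnp_probE (P : graph n -> Prop) :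
  gnp_prob p P = gnp_mean p (fun G => `[< P G >]%:R).
Proof.
rewrite /gnp_prob /gnp_mean big_mkcond; apply: eq_bigr => G _.
by case: ifP; rewrite ?mulr1 ?mulr0.
Qed.

Lemma gnp_prob_le1 (P : graph n -> Prop) : gnp_prob p P <= 1.
Proof.
rewrite gnp_probE -[leRHS](gnp_mean1 n p); apply: le_gnp_mean => // G.
by rewrite lern1 leq_b1.
Qed.

Lemma gnp_prob_homology_eq0 (m l k s : nat) : (0 < n)%N ->
  let c := (l.+2 * m)%N in (s <= n %/ c.+1 - l.+2)%N ->
  1 - (n ^ l.+2)%:R * (c%:R * (2 ^+ k * (1 - p ^+ l.+1 / 2) ^+ s) +
    (1 - (1 - (1 - p) ^+ k) ^+ c) ^+ s) <=
  gnp_prob p (fun G : graph n =>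
    forall x : reduced_homology (multineighbor_complex m G) l, x = 0).
Proof.
move=> n0 c s_le; set t := (X in _ * X).
pose bad (tau : {set 'I_n}) G := ~~ [exists w, filling_apex m G tau w].
have badP (tau : {set 'I_n}) : #|tau| = l.+2 -> gnp_mean p (fun G => (bad tau G)%:R) <= t.
  by move=> tauE; have := @gnp_mean_no_filling_apex m k s tau; rewrite tauE; apply.
rewrite gnp_probE.
(* One minus the number of bad [tau] is at most the indicator of vanishing homology: it is [1] if no
   [tau] is bad and at most [0] otherwise. *)
apply: (le_trans _ (le_gnp_mean p01 (f := fun G =>
  1 - \sum_(tau : {set 'I_n} | #|tau| == l.+2) (bad tau G)%:R) _)).
  rewrite gnp_mean_onem lerD2l lerN2 gnp_mean_sum.
  apply: (@le_trans _ _ (\sum_(tau : {set 'I_n} | #|tau| == l.+2) t)).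
    by apply: ler_sum => tau /eqP/badP.
  rewrite sumr_const -[leLHS]mulr_natl.
  case/andP: p01 => p0 p1.
  have e01 (x : R) j : 0 <= x <= 1 -> 0 <= 1 - x ^+ j <= 1.
    by move=> /andP[x0 x1]; rewrite subr_ge0 exprn_ile1 // gerBl exprn_ge0.
  have q01 : 0 <= 1 - p <= 1 by lra.
  have t0 : 0 <= t.
    rewrite addr_ge0 //.
      rewrite mulr_ge0 // mulr_ge0 ?exprn_ge0 //.
      by have /andP[_ ] := e01 p l.+1 p01; have := exprn_ile1 l.+1 p0 p1; lra.
    by rewrite exprn_ge0 //; case/andP: (e01 _ (l.+2 * m)%N (e01 _ k q01)).
  rewrite ler_wpM2r // ler_nat.
  rewrite -(@eq_card _ [set tau : {set 'I_n} | #|tau| == l.+2]);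
    last by move=> tau; rewrite inE.
  by rewrite card_draws card_ord leq_bin_expn.
move=> G; have [/forall_inP good|] :=
  boolP [forall (tau : {set 'I_n} | #|tau| == l.+2), ~~ bad tau G].
  rewrite asboolT; first by rewrite gerBl sumr_ge0.
  apply: (reduced_homology_eq0 (Ordinal n0)) => tau /eqP/good.
  by rewrite negbK => /existsP[w /forall_inP wP]; exists w.
rewrite negb_forall_in => /exists_inP[tau tauE]; rewrite negbK => btau.
rewrite (bigD1 tau) //= btau opprD addrA subrr add0r.
by apply: (@le_trans _ _ 0); rewrite // oppr_le0 sumr_ge0.
Qed.

End NoApex.

(** * Asymptotics *)

(** A single term of the exponential series. *)
Lemma expr_le_fact_expR (R : realType) (x : R) (k : nat) :
  0 <= x -> x ^+ k <= k`!%:R * expR x.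
Proof.
case: k => [|k] x0.
  by rewrite expr0 mul1r (le_trans _ (expR_ge1Dx x)) // lerDl.
rewrite mulrC -ler_pdivrMr ?ltr0n ?fact_gt0 //.
by apply: le_trans (expR_ge1Dxn k x0); rewrite lerDr.
Qed.

Lemma poly_expRN_le (R : realType) (L : nat) (b : R) : 0 < b ->
  exists2 C : R, 0 <= C & forall (n : nat) (x : R), (0 < n)%N -> 0 <= x ->
    n%:R <= x ^+ L -> n%:R ^+ L * expR (- (b * x)) <= C / n%:R.
Proof.
(* With this exponent [x ^+ K >= n ^ L.+1], enough to absorb [n ^ L] and leave a factor [1 / n]. *)
move=> b0; pose K := (L * L.+1)%N.
exists (K`!%:R / b ^+ K) => [|n x n0 x0 nx].
  by rewrite divr_ge0 // exprn_ge0 // ltW.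
have n0' : 0 < (n%:R : R) by rewrite ltr0n.
rewrite expRN ler_pdivrMr ?expR_gt0 // mulrAC ler_pdivlMr // -exprSr.
rewrite mulrAC ler_pdivlMr ?exprn_gt0 //.
have bx0 : 0 <= b * x by rewrite mulr_ge0 // ltW.
apply: le_trans (expr_le_fact_expR K bx0).
rewrite exprMn mulrC ler_wpM2l ?exprn_ge0 ?(ltW b0) //.
by rewrite /K exprM lerXn2r // ?nnegrE ?exprn_ge0.
Qed.

Lemma onem_expr_le_expR (R : realType) (x : R) (k : nat) : x <= 1 ->
  (1 - x) ^+ k <= expR (- (x * k%:R)).
Proof.
move=> x1; rewrite -mulNr expRM_natr lerXn2r ?nnegrE ?subr_ge0 ?expR_ge0 //.
exact: expR_ge1Dx.
Qed.

(* With [x = n p ^ l.+1], both error terms decay exponentially in [x], and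
   [n p ^ l.+2 >= 1] gives [x ^ l.+2 >= n]. *)
Lemma error_bound (R : realType) (l c : nat) (a : R) : 0 < a ->
  exists2 C : R, 0 <= C & forall (n s : nat) (p : R), (0 < n)%N -> 0 <= p <= 1 ->
    1 <= n%:R * p ^+ l.+2 -> a * n%:R <= s%:R ->
    exists k : nat,
      (n ^ l.+2)%:R * (c%:R * (2 ^+ k * (1 - p ^+ l.+1 / 2) ^+ s) +
        (1 - (1 - (1 - p) ^+ k) ^+ c) ^+ s) <= C / n%:R.
Proof.
(* [r] will bound [(1 - p) ^+ k], the chance of missing a set of [k] vertices; [delta] then bounds
   below the chance of hitting all [c] sets. *)
move=> a0; pose r := expR (- (a / 4)); pose delta := (1 - r) ^+ c.
have a4 : 0 < a / 4 by lra.
have r0 : 0 < r by exact: expR_gt0.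
have r1 : r < 1 by rewrite /r expR_lt1; lra.
have d0 : 0 < delta by rewrite exprn_gt0 // subr_gt0.
have d1 : delta <= 1 by rewrite exprn_ile1 //; lra.
have da0 : 0 < delta * a by rewrite mulr_gt0.
have [C1 C1_ge0 C1P] := poly_expRN_le l.+2 a4.
have [C2 C2_ge0 C2P] := poly_expRN_le l.+2 da0.
exists (c%:R * expR 1 * C1 + C2) => [|n s p n0 /andP[p0 p1] np sn].
  by rewrite addr_ge0 // !mulr_ge0 // expR_ge0.
have n0' : 0 < (n%:R : R) by rewrite ltr0n.
set q := p ^+ l.+1; pose x := n%:R * q.
have q0 : 0 <= q by rewrite exprn_ge0.
have q1 : q <= 1 by rewrite exprn_ile1.
have x0 : 0 <= x by rewrite mulr_ge0 // ltW.
have xn : x <= n%:R by rewrite ler_piMr // ltW.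
have nx : n%:R <= x ^+ l.+2.
  have -> : x ^+ l.+2 = n%:R * (n%:R * p ^+ l.+2) ^+ l.+1.
    rewrite /x /q (exprMn l.+2) (exprMn l.+1) -(exprM p) -(exprM p) mulnC.
    by rewrite mulrA -exprS.
  by rewrite ler_peMr ?(ltW n0') // exprn_ege1.
have qs0 : 0 <= q * s%:R / 4 by rewrite divr_ge0 // mulr_ge0.
(* About [q s / 4]: small enough that [2 ^ k <= expR k] loses to [expR (- (q s / 2))], large enough
   that [p k >= a / 4]. Rounding up costs the factor [expR 1]. *)
pose k := (Num.truncn (q * s%:R / 4)).+1.
have /andP[k_le k_gt] : (Num.truncn (q * s%:R / 4))%:R <= q * s%:R / 4 < k%:R.
  by rewrite truncn_itv.
have k_le' : k%:R <= q * s%:R / 4 + 1 by rewrite /k -natr1 lerD2r.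
have sx : a * x <= q * s%:R.
  by rewrite /x mulrA mulrC ler_wpM2l.
exists k; rewrite natrX mulrDr.
have term1 : 2 ^+ k * (1 - q / 2) ^+ s <= expR 1 * expR (- (a / 4 * x)).
  have e2 : (2 : R) ^+ k <= expR k%:R.
    rewrite -[k%:R]mul1r expRM_natr lerXn2r ?nnegrE ?expR_ge0 //.
    by apply: le_trans (expR_ge1Dx 1); lra.
  have eq2 : (1 - q / 2) ^+ s <= expR (- (q / 2 * s%:R)) by apply: onem_expr_le_expR; lra.
  apply: (le_trans (ler_pM _ _ e2 eq2)); rewrite ?exprn_ge0 //; first by lra.
  by rewrite -!expRD ler_expR; lra.
have pk : (1 - p) ^+ k <= r.
  apply: (le_trans (onem_expr_le_expR k p1)); rewrite /r ler_expR lerN2.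
  (* Here [n p ^ l.+2 >= 1] enters, through [p x = n p ^ l.+2]. *)
  have pq : a * 1 <= p * (q * s%:R).
    apply: (@le_trans _ _ (p * (a * x))); last by rewrite ler_wpM2l.
    have -> : p * (a * x) = a * (n%:R * p ^+ l.+2).
      by rewrite /x /q [p ^+ l.+2]exprS; ring.
    by rewrite ler_wpM2l // ltW.
  have : p * (q * s%:R / 4) <= p * k%:R by rewrite ler_wpM2l // ltW.
  by lra.
have term2 : (1 - (1 - (1 - p) ^+ k) ^+ c) ^+ s <= expR (- (delta * a * x)).
  have pk0 : 0 <= (1 - p) ^+ k by rewrite exprn_ge0 // subr_ge0.
  have dk : delta <= (1 - (1 - p) ^+ k) ^+ c.
    by rewrite lerXn2r ?nnegrE ?subr_ge0 ?(ltW r1) ?lerD2l ?lerN2 // (le_trans pk) // ltW.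
  apply: (@le_trans _ _ ((1 - delta) ^+ s)).
    rewrite lerXn2r ?nnegrE ?subr_ge0 ?lerD2l ?lerN2 // exprn_ile1 //; lra.
  apply: (le_trans (onem_expr_le_expR s d1)).
  rewrite ler_expR lerN2 -mulrA ler_wpM2l ?(ltW d0) //.
  by apply: le_trans sn; rewrite ler_wpM2l // ltW.
rewrite mulrDl; apply: lerD.
  apply: (@le_trans _ _ (n%:R ^+ l.+2 * (c%:R * (expR 1 * expR (- (a / 4 * x)))))).
    by rewrite ler_wpM2l ?exprn_ge0 // ler_wpM2l.
  rewrite mulrCA [X in _ * X]mulrCA mulrA -[leRHS]mulrA ler_wpM2l ?mulr_ge0 ?expR_ge0 //.
  exact: C1P.
apply: le_trans (C2P n x n0 x0 nx); by rewrite ler_wpM2l ?exprn_ge0.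
Qed.

(** The bound [alpha >= - 1 / L] says [alpha L >= -1], hence [n ^ (alpha L) >= 1 / n]. *)
Lemma powR_window (R : realType) (n L : nat) (alpha : R) : (0 < n)%N -> (0 < L)%N ->
  - L%:R^-1 <= alpha <= 0 ->
  0 <= (n%:R : R) `^ alpha <= 1 /\ 1 <= (n%:R : R) * (n%:R `^ alpha) ^+ L.
Proof.
move=> n0 L0 /andP[aL a0]; have n1 : 1 <= (n%:R : R) by rewrite ler1n.
have n0' : 0 < (n%:R : R) by rewrite ltr0n.
split; first by rewrite powR_ge0 /= -[leRHS](powRr0 n%:R) ler_powR.
rewrite -powR_mulrn ?powR_ge0 // -powRrM mulrC -ler_pdivrMr // mul1r.
rewrite -powR_inv1 ?(ltW n0') // ler_powR //.
by rewrite -ler_pdivrMr ?ltr0n // mulN1r.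
Qed.

Theorem proposition3 (R : realType) (m l : nat) (alpha : R) :
  (0 < m)%N ->
  - (l.+2%:R)^-1 <= alpha <= 0 ->
  gnp_aas (fun n : nat => (n%:R : R) `^ alpha)
    (fun n (G : graph n) =>
       forall x : reduced_homology (multineighbor_complex m G) l, x = 0).
Proof.
(* [a] is half of [1 / c.+1], so that [s], about [n / c.+1], still exceeds [a n] for large [n]
   despite rounding and the removal of [tau]. *)
move=> m0 alphaP; pose c := (l.+2 * m)%N; pose a : R := (2 * c.+1%:R)^-1.
have c0 : 0 < (c.+1%:R : R) by rewrite ltr0n.
have a0 : 0 < a by rewrite invr_gt0 mulr_gt0.
have [C C0 CP] := error_bound l c a0.
apply/cvgrPdist_le => e e0; near=> n.
have n0 : (0 < n)%N by near: n; exact: nbhs_infty_gt.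
have n0' : 0 < (n%:R : R) by rewrite ltr0n.
have [p01 np] := powR_window n0 (ltn0Sn l.+1) alphaP.
pose s := (n %/ c.+1 - l.+2)%N.
have sn : a * n%:R <= s%:R.
  have n_big : l.+3%:R / a <= n%:R by near: n; exact: nbhs_infty_ger.
  (* The extra [1] in [l.+3] pays for the rounding in [n %/ c.+1]. *)
  have : (n < (s + l.+3) * c.+1)%N.
    rewrite (leq_trans (ltn_ceil n (ltn0Sn c))) // leq_mul2r addnS ltnS /=.
    by rewrite addnC -leq_subLR.
  rewrite ler_pdivrMr // in n_big.
  rewrite -(ltr_nat R) natrM natrD -ltr_pdivrMr // => ns.
  have nE : n%:R / c.+1%:R = 2 * (n%:R * a).
    by rewrite /a invfM; field; rewrite addr_eq0 ?gt_eqF.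
  by move: ns n_big; rewrite nE (mulrC n%:R); move: (a * _) s%:R l.+3%:R => u v w; lra.
have [k kP] := CP n s _ n0 p01 np sn.
have := gnp_prob_homology_eq0 (m := m) p01 k n0 (leqnn _).
move=> prob_ge.
have prob_le1 := gnp_prob_le1 p01
  (fun G : graph n => forall x : reduced_homology (multineighbor_complex m G) l, x = 0).
(* The failure probability is at most [C / n], which is below [e] as soon as [n >= C / e]. *)
rewrite ger0_norm ?subr_ge0 // lerBlDr -lerBlDl.
apply: le_trans (prob_ge l); rewrite lerD2l lerN2 (le_trans kP) //.
rewrite ler_pdivrMr // mulrC -ler_pdivrMr //.
by near: n; exact: nbhs_infty_ger.
Unshelve. all: by end_near.
Qed.
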